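(* Consider the model $Y=f(\mathbf{X})+\varepsilon$, where $\mathbf{X}$ is a $p$-dimensional random vector, $f:\mathbb{R}^p\to\mathbb{R}$ is measurable and $\varepsilon$ is a real random variable (the noise). Assume that $f(\mathbf{X})$ and the noise $\varepsilon$ are independent and that $f(\mathbf{X})$ has a continuous distribution function. Then the Markov product $(Y,Y')$ of $(Y,f(\mathbf{X}))$ is weakly continuous, and $\xi(Y,\mathbf{X})$ is continuous, with respect to weak convergence in $\varepsilon$. That is: if $(\varepsilon_n)_{n\in\mathbb{N}}$ are real random variables such that, for every $n$, $f(\mathbf{X})$ and $\varepsilon_n$ are independent, if $\varepsilon_n\to\varepsilon$ in distribution, and if $Y_n=f(\mathbf{X})+\varepsilon_n$, then the Markov product of $(Y_n,f(\mathbf{X}))$ converges weakly to the Markov product of $(Y,f(\mathbf{X}))$, and $\xi(Y_n,\mathbf{X})\to\xi(Y,\mathbf{X})$.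
   Context: For a non-degenerate real random variable $Y$ and a random vector $\mathbf{X}$, Chatterjee's rank correlation is $$\xi(Y,\mathbf{X}) := \frac{\int_{\mathbb{R}} \mathrm{Var}(P(Y\ge y\mid \mathbf{X}))\,\mathrm{d}P^{Y}(y)}{\int_{\mathbb{R}} \mathrm{Var}(\mathbf{1}_{\{Y\ge y\}})\,\mathrm{d}P^{Y}(y)},$$ where $P^Y$ is the distribution of $Y$. The Markov product of a random vector $(Y,\mathbf{Z})$ ($Y$ real-valued) is the distribution of the bivariate vector $(Y,Y')$, where $Y'$ is a conditionally independent copy of $Y$ relative to $\mathbf{Z}$, i.e. the conditional distribution of $Y'$ given $\mathbf{Z}=\mathbf{z}$ equals that of $Y$ given $\mathbf{Z}=\mathbf{z}$ for $P^{\mathbf{Z}}$-almost all $\mathbf{z}$, and $Y$ and $Y'$ are conditionally independent given $\mathbf{Z}$.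
   Formalization: For the convergence of ξ(Y_n,X), X itself (not only f(X)) is assumed independent of ε and of every ε_n; otherwise it fails: U,V,W iid uniform, X=(U,V), f(X)=U, ε_n=V, ε=W gives ξ(Y_n,X)=1 but ξ(Y,X)<1. *)

(* Defs.v *)
From HB Require Import structures.
From mathcomp Require Import all_boot all_order all_algebra.
From mathcomp Require Import all_classical all_reals all_analysis.

Set Implicit Arguments.
Unset Strict Implicit.
Unset Printing Implicit Defensive.

Import Order.TTheory GRing.Theory Num.Theory.
Import numFieldNormedType.Exports.

Local Open Scope classical_set_scope.
Local Open Scope ring_scope.

Definition independent_RVs d d1 d2 (T : measurableType d)
    (S1 : measurableType d1) (S2 : measurableType d2) (R : realType)
    (P : probability T R) (U : T -> S1) (V : T -> S2) : Prop :=
  forall (A : set S1) (B : set S2), measurable A -> measurable B ->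
    P (U @^-1` A `&` V @^-1` B) = (P (U @^-1` A) * P (V @^-1` B))%E.

Definition weakly_cvg_R (R : realType)
    (nu_ : nat -> probability R R) (nu : probability R R) : Prop :=
  forall g : R -> R, continuous g -> [bounded g x | x in [set: R]] ->
    (\int[nu_ n]_x (g x)%:E)%E @[n --> \oo] --> (\int[nu]_x (g x)%:E)%E.

Definition weakly_cvg_R2 (R : realType)
    (nu_ : nat -> probability (R * R)%type R)
    (nu : probability (R * R)%type R) : Prop :=
  forall g : R * R -> R,
    continuous g -> [bounded g x | x in [set: R * R]] ->
    (\int[nu_ n]_x (g x)%:E)%E @[n --> \oo] --> (\int[nu]_x (g x)%:E)%E.

Definition cvg_in_distribution d (T : measurableType d) (R : realType)
    (P : probability T R) (U_ : nat -> {RV P >-> R}) (U : {RV P >-> R}) : Prop :=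
  weakly_cvg_R (fun n => distribution P (U_ n)) (distribution P U).

Section conditioning.
Context d dS (T : measurableType d) (S : measurableType dS) (R : realType).
Variables (P : probability T R) (Z : {RV P >-> S}).

(* [g z] is a version of P(A | Z = z), so that [g \o Z] is one of P(A | Z). *)
Definition is_cond_prob (A : set T) (g : S -> R) : Prop :=
  (distribution P Z).-integrable [set: S] (EFin \o g) /\
  forall C : set S, measurable C ->
    P (A `&` Z @^-1` C) = (\int[distribution P Z]_(z in C) (g z)%:E)%E.

(* A version exists for every measurable [A] (Radon-Nikodym) and is unique
   up to a [distribution P Z]-null set; the default 0 is never used then. *)
Definition cond_prob (A : set T) : S -> R := xget (fun=> 0) (is_cond_prob A).

Definition is_cond_distribution dW (W : measurableType dW)
    (Y : {RV P >-> W}) (k : R.-pker S ~> W) : Prop :=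
  forall (B : set W) (C : set S), measurable B -> measurable C ->
    P (Y @^-1` B `&` Z @^-1` C) = (\int[distribution P Z]_(z in C) k z B)%E.

Definition same_cond_distribution dW (W : measurableType dW)
    (Y Y' : {RV P >-> W}) : Prop :=
  exists k k' : R.-pker S ~> W,
    [/\ is_cond_distribution Y k, is_cond_distribution Y' k' &
      {ae distribution P Z, forall z, forall B, measurable B -> k z B = k' z B}].

Definition cond_independent d1 d2 (W1 : measurableType d1)
    (W2 : measurableType d2) (Y1 : {RV P >-> W1}) (Y2 : {RV P >-> W2}) : Prop :=
  forall (B : set W1) (C : set W2), measurable B -> measurable C ->
    {ae distribution P Z, forall z,
      cond_prob (Y1 @^-1` B `&` Y2 @^-1` C) z =
      cond_prob (Y1 @^-1` B) z * cond_prob (Y2 @^-1` C) z}.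

Definition cond_independent_copy dW (W : measurableType dW)
    (Y Y' : {RV P >-> W}) : Prop :=
  same_cond_distribution Y Y' /\ cond_independent Y Y'.

End conditioning.

(* The space carrying (Y, Z) need not be rich enough to carry a conditionally
   independent copy of Y, so the copy is taken on some space carrying a vector
   with the same law as (Y, Z). *)
Definition is_markov_product d dS (T : measurableType d)
    (S : measurableType dS) (R : realType) (P : probability T R)
    (Y : {RV P >-> R}) (Z : {RV P >-> S})
    (nu : probability (R * R)%type R) : Prop :=
  exists (d' : measure_display) (T' : measurableType d')
    (Q : probability T' R)
    (Y1 Y2 : {RV Q >-> R}) (Z' : {RV Q >-> S}),
    [/\ forall A : set (R * S), measurable A ->
          Q ((fun w => (Y1 w, Z' w)) @^-1` A) = P ((fun w => (Y w, Z w)) @^-1` A),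
        cond_independent_copy Z' Y1 Y2 &
        forall A : set (R * R), measurable A ->
          nu A = Q ((fun w => (Y1 w, Y2 w)) @^-1` A)].

(* For degenerate Y the denominator is 0 and the value is 0 by convention. *)
Definition xi d dS (T : measurableType d) (S : measurableType dS)
    (R : realType) (P : probability T R)
    (Y : {RV P >-> R}) (X : {RV P >-> S}) : R :=
  fine (\int[distribution P Y]_y
          'V_P[cond_prob X (Y @^-1` `[y, +oo[) \o X])%E /
  fine (\int[distribution P Y]_y 'V_P[\1_(Y @^-1` `[y, +oo[)])%E.

(* Main.v *)
Require Import Defs.
From HB Require Import structures.
From mathcomp Require Import all_boot all_order all_algebra.
From mathcomp Require Import all_classical all_reals all_analysis.
From mathcomp Require Import measurable_realfun lra.

Set Implicit Arguments.
Unset Strict Implicit.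
Unset Printing Implicit Defensive.

Import Order.TTheory GRing.Theory Num.Theory.
Import numFieldNormedType.Exports.

Local Open Scope classical_set_scope.
Local Open Scope ring_scope.

(* Write mu_n, mu for the laws of the noises and rho for that of f(X).  Given
   f(X) = z, the variable Y_n is distributed as z + q_n(u) with u uniform on
   [0, 1] and q_n the quantile function of mu_n; hence the Markov product of
   (Y_n, f(X)) is the law of (z + q_n(u), z + q_n(v)) for (z, u, v) distributed
   as rho x unif x unif.  Weak convergence of mu_n gives q_n -> q almost
   everywhere, so bounded convergence yields the first claim.  For xi, both
   numerator and denominator integrate, against the law of z + q_n(u),
   polynomials in the moments of P(Y_n >= y | f(X)).  As rho has no atoms, these
   moments converge at y_n whenever y_n -> y, and bounded convergence applies
   again; the limiting denominator is positive since Y has no atoms. *)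

(** * Laws on product spaces and change of variables *)

Section measures.
Context d1 d2 (T1 : measurableType d1) (T2 : measurableType d2) (R : realType).

(** Measurable rectangles are stable under intersection and generate the product sigma-algebra. *)
Lemma measure_prod_unique (m1 m2 : probability (T1 * T2)%type R) :
  (forall A B, measurable A -> measurable B -> m1 (A `*` B) = m2 (A `*` B)) ->
  forall X, measurable X -> m1 X = m2 X.
Proof.
move=> m12 X mX.
pose C := [set A `*` B | A in measurable & B in measurable] :
  set (set (T1 * T2)).
apply: (measure_unique C (fun=> setT)) => //.
- exact: measurable_prod_measurableType.
- move=> _ _ [X1 mX1 [X2 mX2 <-]] [Y1 mY1 [Y2 mY2 <-]].
  exists (X1 `&` Y1); first exact: measurableI.
  by exists (X2 `&` Y2); [exact: measurableI|rewrite setXI].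
- by move=> _; exists setT => //; exists setT => //; rewrite setXTT.
- by rewrite bigcup_const//; exists 0%N.
- by move=> _ [A mA [B mB <-]]; exact: m12.
- by move=> _; rewrite [ltLHS]probability_setT ltry.
Qed.

Variables (m1 : probability T1 R) (m2 : probability T2 R) (phi : T1 -> T2).
Hypotheses (mphi : measurable_fun setT phi)
  (phiE : forall A, measurable A -> m1 (phi @^-1` A) = m2 A).

Lemma ae_preimage (Q : T2 -> Prop) :
  {ae m2, forall y, Q y} -> {ae m1, forall x, Q (phi x)}.
Proof.
move=> [N [mN N0 QN]]; exists (phi @^-1` N); split.
- by rewrite -[X in measurable X]setTI; exact: mphi.
- exact: eq_trans (phiE mN) N0.
- by move=> x nQx; exact: QN.
Qed.

Lemma integral_preimage (f : T2 -> R) : measurable_fun setT f ->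
  [bounded f y | y in setT] ->
  (\int[m2]_y (f y)%:E = \int[m1]_x (f (phi x))%:E)%E.
Proof.
move=> mf bf; transitivity (\int[pushforward m1 phi]_y (f y)%:E)%E.
  by apply: eq_measure_integral => A mA _; exact/esym/phiE.
rewrite (@integral_pushforward _ _ _ _ _ _ mphi m1 setT (EFin \o f)) //.
  exact/measurable_EFinP.
rewrite preimage_setT; apply: measurable_bounded_integrable => //.
- by rewrite [ltLHS]probability_setT ltry.
- exact: measurableT_comp.
- by case: bf => M [Mr bM]; exists M; split => // K MK x _; exact: bM.
Qed.

End measures.

(** The sigma-algebra on the plane is the product one, so open sets must be shown to belong to it:
    each is a countable union of rational boxes. *)
Lemma continuous_measurable_fun2 (R : realType) (g : R * R -> R) :
  continuous g -> measurable_fun setT g.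
Proof.
move=> cg; have open_meas (O : set (R * R)) : open O -> measurable O.
  move=> oO.
  pose box (i : rat * rat * rat) : set (R * R) :=
    ball (ratr i.1.1 : R) (ratr i.2 : R) `*` ball (ratr i.1.2 : R) (ratr i.2).
  (* Boxes that are not contained in [O], and codes that encode no box, contribute the empty set. *)
  pose F n := if unpickle n is Some i then
    (if `[< box i `<=` O >] then box i else set0) else set0.
  have -> : O = \bigcup_n F n.
    apply/seteqP; split=> [[x y] Oxy|x [n _]]; last first.
      rewrite /F; case: unpickle => [i|//]; case: asboolP => // bO.
      exact: bO.
    have /nbhs_ballP[e /= e0 eO] : nbhs (x, y) O by exact: oO.
    (* With a radius [r] below [e / 2] and a centre within [r] of the point, every point of the box
       is within [2r < e] of it. *)
    have e20 : 0 < e / 2 by rewrite divr_gt0.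
    have [r] := rat_in_itvoo e20; rewrite in_itv/= => /andP[r0 re].
    have [a] : exists a : rat, ratr a \in `](x - ratr r), (x + ratr r)[.
      by apply: rat_in_itvoo; rewrite ltrBlDr -addrA ltrDl addr_gt0.
    rewrite in_itv/= => /andP[a1 a2].
    have [b] : exists b : rat, ratr b \in `](y - ratr r), (y + ratr r)[.
      by apply: rat_in_itvoo; rewrite ltrBlDr -addrA ltrDl addr_gt0.
    rewrite in_itv/= => /andP[b1 b2].
    have near_ (u v w : R) : v - ratr r < u -> u < v + ratr r ->
        `|u - w| < ratr r -> `|v - w| < e.
      rewrite !ltr_distl => u1 u2 /andP[u3 u4].
      move: re; rewrite ltr_pdivlMr// mulr_natr mulr2n => re.
      by apply/andP; split; lra.
    exists (pickle (a, b, r)); first exact: I.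
    rewrite /F pickleK; case: asboolP.
      move=> _; split; rewrite /ball/= ltr_distl;
        by apply/andP; split; lra.
    move=> /=; case => -[u v] [/= bu bv]; apply: eO.
    by split => /=; [exact: near_ bu|exact: near_ bv].
  apply: bigcupT_measurable => n; rewrite /F; case: unpickle => // i.
  case: ifP => // _; apply: measurableX; exact: open_measurable (ball_open _ _).
apply: (measurability _ (RGenOpens.measurableE R)).
move=> _ [_ [a [b ->] <-]]; rewrite setTI; apply: open_meas.
by move/continuousP : cg; apply; exact: interval_open.
Qed.

(** * Bounded convergence and eventual inequalities *)

Section bounded_convergence.
Context d (T : measurableType d) (R : realType) (P : probability T R).

Lemma probability_bounded_integrable (f : T -> R) (M : R) :
  measurable_fun setT f -> (forall x, `|f x| <= M) ->
  P.-integrable setT (EFin \o f).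
Proof.
move=> mf fM; apply: measurable_bounded_integrable => //.
- by rewrite [ltLHS]probability_setT ltry.
- by exists M; split=> [|K MK x _]; [exact: num_real|exact: le_trans (ltW MK)].
Qed.

Variables (f_ : nat -> T -> R) (f : T -> R) (M : R).
Hypotheses (mf_ : forall n, measurable_fun setT (f_ n))
  (mf : measurable_fun setT f) (f_M : forall n x, `|f_ n x| <= M)
  (f_f : {ae P, forall x, f_ n x @[n --> \oo] --> f x}).

Lemma bounded_convergence :
  (\int[P]_x (f_ n x)%:E @[n --> \oo] --> \int[P]_x (f x)%:E)%E.
Proof.
have [] := @dominated_convergence _ _ _ P setT measurableT
  (fun n x => (f_ n x)%:E) (EFin \o f) (cst M%:E) => //.
- by move=> n; exact/measurable_EFinP.
- exact/measurable_EFinP.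
- by apply: filterS f_f => x fx _; apply/fine_cvgP; split => //; exact: nearW.
- exact: (@probability_bounded_integrable (cst M) `|M|).
- by apply: aeW => x n _; rewrite lee_fin.
Qed.

Hypothesis fM : forall x, `|f x| <= M.

Lemma bounded_convergence_R :
  \int[P]_x f_ n x @[n --> \oo] --> \int[P]_x f x.
Proof.
rewrite /Rintegral; apply: fine_cvg; rewrite fineK.
  exact: bounded_convergence.
by apply: integrable_fin_num => //; exact: probability_bounded_integrable fM.
Qed.

End bounded_convergence.

Section near_order_cvge.
Context (R : realType) (I : Type) (F : set_system I).
Context {FF : Filter F}.
Variables (f : I -> \bar R) (c l : \bar R).
Hypothesis fl : f @ F --> l.

Lemma near_gt_cvge : (c < l)%E -> \forall x \near F, (c < f x)%E.
Proof.
move=> cl; move: (@fl [set y | (c < y)%E]); apply.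
by apply: open_nbhs_nbhs; split => //; exact: open_ereal_gt_ereal.
Qed.

Lemma near_lt_cvge : (l < c)%E -> \forall x \near F, (f x < c)%E.
Proof.
move=> lc; move: (@fl [set y | (y < c)%E]); apply.
by apply: open_nbhs_nbhs; split => //; exact: open_ereal_lt_ereal.
Qed.

End near_order_cvge.

(** The complements, the open upper rays, form a generating family stable under intersection. *)
Lemma measure_itvNyc_unique (R : realType) (m1 m2 : probability R R) :
  (forall x, m1 `]-oo, x]%classic = m2 `]-oo, x]%classic) ->
  forall A, measurable A -> m1 A = m2 A.
Proof.
move=> m12 A mA; apply: (measure_unique (@RGenOInfty.G R)
  (fun n => `]- (n%:R : R), +oo[%classic)) => //.
- exact: RGenOInfty.measurableE.
- move=> _ _ [x ->] [y ->]; exists (Num.max x y).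
  by apply/seteqP; split=> z /=; rewrite !in_itv/= !andbT gt_max;
    [case=> -> ->|move=> /andP[]].
- by move=> n; exists (- n%:R).
- apply/seteqP; split=> // x _; exists (Num.bound `|x|) => //=.
  rewrite in_itv/= andbT ltrNl; apply: le_lt_trans (ler_norm _) _.
  by rewrite normrN archi_boundP.
- move=> _ [x ->]; rewrite -setCitvl.
  by rewrite [LHS]probability_setC// [RHS]probability_setC// m12.
- by move=> n; apply: (le_lt_trans (probability_le1 _ _)); rewrite ?ltry.
Qed.

(** * Quantile functions and their law under the uniform distribution *)

Section quantile.
Context d (T : measurableType d) (R : realType) (P : probability T R).
Variable X : {RV P >-> R}.

(* The value outside the unit interval only serves to make this a total
   measurable function. *)
Definition quantile (u : measurableTypeR R) : R :=
  if (u : R) \in `]0, 1[ then inf [set x | (u%:E <= cdf X x)%E] else 0.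

(** The limits 0 and 1 of the distribution function make the set under the infimum bounded below and
    nonempty. If [cdf X x < u], right-continuity gives some [y > x] with [cdf X y < u]; this [y] is
    a lower bound of the set, so the quantile exceeds [x]. *)
Lemma quantile_le (u x : R) : u \in `]0, 1[ ->
  (quantile u <= x) = (u%:E <= cdf X x)%E.
Proof.
move=> u01; rewrite /quantile u01; set S := [set x | _].
move: u01; rewrite in_itv/= => /andP[u0 u1].
have lt_S x' s : (cdf X x' < u%:E)%E -> S s -> x' <= s.
  move=> xu us; rewrite leNgt; apply/negP => /ltW sx.
  have := le_lt_trans (le_trans us (cdf_nondecreasing X sx)) xu.
  by rewrite ltxx.
have S0 : S !=set0.
  have /near_gt_cvge/(_ (ltac:(by rewrite lte_fin) : (u%:E < 1)%E)) :=
    @cvg_cdfy1 _ _ _ P X.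
  by move=> /filter_ex[y uy]; exists y; exact: ltW.
have Slb : has_lbound S.
  have /near_lt_cvge/(_ (ltac:(by rewrite lte_fin) : (0 < u%:E)%E)) :=
    @cvg_cdfNy0 _ _ _ P X.
  by move=> /filter_ex[y uy]; exists y => s; exact: lt_S.
apply/idP/idP => [qx|Sx]; last exact: ge_inf.
rewrite leNgt; apply/negP => xu.
have /near_lt_cvge/(_ xu) := @cdf_right_continuous _ _ _ P X x.
move=> /(filterI (nbhs_right_gt x))/filter_ex[y [xy yu]].
suff : y <= x by rewrite leNgt xy.
by apply: le_trans qx; apply: lb_le_inf => // s; exact: lt_S.
Qed.

Lemma measurable_quantile : measurable_fun setT quantile.
Proof.
apply: (measurability _ (RGenOInfty.measurableE R)) => //.
move=> _ [_ [x ->] <-]; rewrite setTI.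
have -> : quantile @^-1` `]x, +oo[ =
    (`]0, 1[ `&` [set u | (cdf X x < u%:E)%E]) `|`
    (~` `]0, 1[ `&` [set u | x < 0]).
  apply/seteqP; split=> u /=; rewrite [quantile u \in _]in_itv/= andbT.
    have [u01|u01] := boolP (u \in `]0, 1[).
      by rewrite ltNge quantile_le// -ltNge; left.
    by rewrite /quantile (negbTE u01); right; split => //; exact/negP.
  move=> [[u01 xu]|[/negP u01 x0]].
    by rewrite ltNge quantile_le// -ltNge.
  by rewrite /quantile (negbTE u01).
apply: measurableU; apply: measurableI => //.
- rewrite (_ : [set u | _] = `]fine (cdf X x), +oo[%classic) //.
  apply/seteqP; split=> u /=; rewrite in_itv/= andbT -lte_fin fineK//;
    exact: fin_num_measure.
- exact: measurableC.
- case: (x < 0).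
    by rewrite (_ : [set _ | _] = setT)//; apply/seteqP; split.
  by rewrite (_ : [set _ | _] = set0)//; apply/seteqP; split.
Qed.

HB.instance Definition _ :=
  isMeasurableFun.Build _ _ _ _ quantile measurable_quantile.

Lemma uniform_prob01E (A : set R) : measurable A ->
  uniform_prob (@ltr01 R) A = lebesgue_measure (A `&` `[0, 1]).
Proof.
move=> mA; rewrite /uniform_prob integral_uniform_pdf.
rewrite (eq_integral (cst 1%E)); last first.
  move=> x; rewrite inE => -[_]; rewrite /= in_itv/= /uniform_pdf => ->.
  by rewrite subr0 invr1.
by rewrite integral_cst ?mul1e//; exact: measurableI.
Qed.

(** It is enough to test lower rays. By [quantile_le] the preimage of the ray up to [x] is the
    interval from 0 to [cdf X x], up to the endpoints of the unit interval. *)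
Lemma distribution_quantile (A : set R) : measurable A ->
  uniform_prob (@ltr01 R) (quantile @^-1` A) = distribution P X A.
Proof.
pose Q := quantile : {mfun measurableTypeR R >-> R}.
apply: (@measure_itvNyc_unique R
  (distribution (uniform_prob (@ltr01 R)) Q) (distribution P X)) => x.
rewrite -[RHS]/(cdf X x) -[LHS]/(uniform_prob (@ltr01 R) (quantile @^-1` _)).
have mq : measurable (quantile @^-1` `]-oo, x]).
  by rewrite -[X in measurable X]setTI; exact: measurable_quantile.
rewrite uniform_prob01E//.
have Fx : cdf X x \is a fin_num by exact: fin_num_measure.
have F0 : 0 <= fine (cdf X x) by exact: fine_ge0.
have F1 : fine (cdf X x) <= 1 by rewrite -lee_fin fineK// cdf_le1.
apply/eqP; rewrite eq_le; apply/andP; split.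
(* The point 1 is added because the quantile takes its default value 0 there, so 1 may lie in the
   preimage although [cdf X x < 1]. *)
- apply: (@le_trans _ _ (lebesgue_measure
      (`[0, fine (cdf X x)]%classic `|` [set (1:R)]))).
    apply: le_measure; rewrite ?inE.
    + exact: measurableI.
    + by apply: measurableU => //; exact: measurable_set1.
    + move=> u [/=]; rewrite !in_itv/= => qu /andP[u0 u1].
      have [->|uneq1] := eqVneq u 1; first by right.
      have [->|uneq0] := eqVneq u 0; first by left; rewrite lexx.
      have u01 : u \in `]0, 1[.
        by rewrite in_itv/= lt_neqAle eq_sym uneq0 u0 lt_neqAle uneq1.
      left; rewrite u0/= -lee_fin fineK// -quantile_le//.
  apply: (le_trans (measureU2 lebesgue_measure (measurable_itv _)
    (measurable_set1 _))).
  rewrite [X in (_ + X)%E]lebesgue_measure_set1 adde0.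
  rewrite [leLHS]lebesgue_measure_itv/= lte_fin.
  by case: ifPn => // _; rewrite sube0 fineK.
- apply: (@le_trans _ _ (lebesgue_measure `]0, fine (cdf X x)[%classic)).
    rewrite lebesgue_measure_itv/= lte_fin; case: ifPn => [_|].
      by rewrite sube0 fineK.
    by rewrite -leNgt -lee_fin fineK.
  apply: le_measure; rewrite ?inE//; first exact: measurableI.
  move=> u /=; rewrite !in_itv/= => /andP[u0 uF].
  have u1 : u < 1 by exact: lt_le_trans F1.
  rewrite (ltW u1) (ltW u0); split => //.
  by rewrite quantile_le ?in_itv/= ?u0// -[leRHS]fineK// lee_fin ltW.
Qed.

End quantile.

(** * From weak convergence to almost everywhere convergence of quantiles *)

Section cdf_weak.
Context d (T : measurableType d) (R : realType) (P : probability T R).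
Variables (X_ : nat -> {RV P >-> R}) (X : {RV P >-> R}).
Hypothesis X_X : cvg_in_distribution X_ X.

(* 1 on ]-oo, x], 0 on [x + e, +oo[ and affine in between *)
Let ramp (x e t : R) : R := Num.min 1 (Num.max 0 ((x + e - t) / e)).

Let ramp_cont x e : continuous (ramp x e).
Proof.
move=> t; apply: (@continuous_min _ _ _ _ t); first exact: cst_continuous.
apply: (@continuous_max _ _ _ _ t); first exact: cst_continuous.
apply: cvgMl; apply: cvgB; [exact: cvg_cst|exact: cvg_id].
Qed.

Let ramp01 x e t : 0 <= ramp x e t <= 1.
Proof. by rewrite /ramp le_min ler01 le_max lexx/= ge_min lexx. Qed.

Let ramp_bounded x e : [bounded ramp x e t | t in setT].
Proof.
exists 1; split => // K K1 t _; have /andP[r0 r1] := ramp01 x e t.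
by rewrite /= ger0_norm// (le_trans r1)// ltW.
Qed.

Let ramp_ge (x e t : R) : 0 < e -> \1_(`]-oo, x]) t <= ramp x e t.
Proof.
move=> e0; rewrite indicE mem_setE in_itv/=.
have [tx|tx] := leP t x; rewrite /= ?mulr0n; last first.
  by have /andP[] := ramp01 x e t.
rewrite /ramp le_min lexx/= le_max; apply/orP; right.
by rewrite ler_pdivlMr// mul1r; lra.
Qed.

Let ramp_le (x e t : R) : 0 < e -> ramp x e t <= \1_(`]-oo, x + e]) t.
Proof.
move=> e0; rewrite indicE mem_setE in_itv/=.
have [tx|tx] := leP t (x + e); rewrite /= ?mulr1n.
  by have /andP[] := ramp01 x e t.
rewrite /ramp ge_min; apply/orP; right; rewrite ge_max lexx/=.
by rewrite pmulr_lle0 ?invr_gt0//; lra.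
Qed.

Let int_ramp_ge (Z : {RV P >-> R}) x e : 0 < e ->
  (cdf Z x <= \int[distribution P Z]_t (ramp x e t)%:E)%E.
Proof.
move=> e0; rewrite /cdf -[`]-oo, x]%classic]setIT -integral_indic//.
apply: ge0_le_integral => //.
- exact/measurable_EFinP.
- by apply/measurable_EFinP; apply: continuous_measurable_fun; exact: ramp_cont.
- by move=> t _; rewrite lee_fin ramp_ge.
Qed.

Let int_ramp_le (Z : {RV P >-> R}) x e : 0 < e ->
  (\int[distribution P Z]_t (ramp x e t)%:E <= cdf Z (x + e))%E.
Proof.
move=> e0; rewrite /cdf -[`]-oo, x + e]%classic]setIT -integral_indic//.
apply: ge0_le_integral => //.
- by move=> t _; rewrite lee_fin; have /andP[] := ramp01 x e t.
- by apply/measurable_EFinP; apply: continuous_measurable_fun; exact: ramp_cont.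
- exact/measurable_EFinP.
- by move=> t _; rewrite lee_fin ramp_le.
Qed.

(** The integral of the ramp converges and lies between the distribution function at [x] and at
    [x + e]. Keeping the slack [e] makes the bound valid at every [x], continuity point or not. *)
Lemma near_lt_cdf (c x e : R) : 0 < e ->
  (c%:E < cdf X x)%E -> \forall n \near \oo, (c%:E < cdf (X_ n) (x + e))%E.
Proof.
move=> e0 cX; have cI := lt_le_trans cX (int_ramp_ge X x e0).
have /near_gt_cvge/(_ cI) := X_X (@ramp_cont x e) (@ramp_bounded x e).
by apply: filterS => n /lt_le_trans; apply; exact: int_ramp_le.
Qed.

Lemma near_cdf_lt (c x e : R) : 0 < e ->
  (cdf X (x + e) < c%:E)%E -> \forall n \near \oo, (cdf (X_ n) x < c%:E)%E.
Proof.
move=> e0 cX; have cI := le_lt_trans (int_ramp_le X x e0) cX.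
have /near_lt_cvge/(_ cI) := X_X (@ramp_cont x e) (@ramp_bounded x e).
by apply: filterS => n; apply: le_lt_trans; exact: int_ramp_ge.
Qed.

(** Convergence can fail only if [cdf X] is flat at height [u]. A flat stretch contains a rational,
    so it suffices that [u] is not the value of [cdf X] at a rational. *)
Lemma cvg_quantile (u : R) : u \in `]0, 1[ ->
  (forall r : rat, cdf X (ratr r) != u%:E) ->
  quantile (X_ n) u @[n --> \oo] --> quantile X u.
Proof.
move=> u01 uF; set q := quantile X u.
apply/cvgrPdist_le => e e0; have e2 : 0 < e / 2 by rewrite divr_gt0.
have [r] : exists r : rat, ratr r \in `]q, q + e / 2[.
  by apply: rat_in_itvoo; rewrite ltrDl.
rewrite in_itv/= => /andP[qr re].
have uFr : (u%:E < cdf X (ratr r))%E.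
  by rewrite lt_neqAle eq_sym uF/= -quantile_le// ltW.
(* This point is below the quantile [q]; the remaining [e / 2] is the slack that [near_cdf_lt]
   consumes. *)
have Fu : (cdf X (q - e + e / 2) < u%:E)%E.
  by rewrite ltNge -quantile_le// -ltNge -/q; lra.
apply: filterS2 (near_lt_cdf e2 uFr) (near_cdf_lt e2 Fu) => n Fn1 Fn2.
have le1 : quantile (X_ n) u <= ratr r + e / 2 by rewrite quantile_le// ltW.
have le2 : q - e < quantile (X_ n) u by rewrite ltNge quantile_le// -ltNge.
by rewrite ler_distl; apply/andP; split; lra.
Qed.

(** Skorokhod's representation on the unit interval. *)
Lemma ae_cvg_quantile : {ae uniform_prob (@ltr01 R), forall u,
  quantile (X_ n) u @[n --> \oo] --> quantile X u}.
Proof.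
(* The countable exceptional set: the endpoints 0 and 1, coded by the booleans, and the values of
   [cdf X] at the rationals. *)
pose h (i : bool + rat) : R :=
  match i with inl b => b%:R | inr r => fine (cdf X (ratr r)) end.
pose C := range h.
have cC : countable C.
  exact: sub_countable (card_image_le _ _) (countableP _).
have mC : measurable C.
  by apply: countable_measurable => // x; exact: measurable_set1.
exists (C `|` ~` `[0, 1]); split.
- by apply: measurableU => //; exact: measurableC.
- rewrite uniform_prob01E; last by apply: measurableU => //; exact: measurableC.
  rewrite setIUl setICl setU0; apply/eqP; rewrite eq_le measure_ge0 andbT.
  rewrite -(countable_lebesgue_measure0 cC) le_measure ?inE//.
  exact: measurableI.
- move=> u; apply: contra_notP => /not_orP[uC /contrapT/=].
  rewrite in_itv/= => /andP[u0 u1]; apply: cvg_quantile.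
    rewrite in_itv/= !lt_neqAle u0 u1 !andbT; apply/andP; split.
      by apply/eqP => u0'; apply: uC; exists (inl false).
    by apply/eqP => u1'; apply: uC; exists (inl true).
  by move=> r; apply/eqP => Fr; apply: uC; exists (inr r); rewrite //= Fr.
Qed.

End cdf_weak.

Definition mfun_of d1 d2 (T1 : measurableType d1) (T2 : measurableType d2)
    (f : T1 -> T2) (mf : measurable_fun setT f) : {mfun T1 >-> T2} :=
  HB.pack f (isMeasurableFun.Build _ _ _ _ f mf).

(** * Existence and uniqueness of conditional probabilities *)

Section cond_prob_theory.
Context d dS (T : measurableType d) (S : measurableType dS) (R : realType).
Variables (P : probability T R) (Z : {RV P >-> S}).

(** The version is the Radon-Nikodym derivative, with respect to the law of [Z], of the finite
    measure taking [C] to the probability of [A] and [Z] in [C]. *)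
Lemma is_cond_prob_exists (A : set T) : measurable A ->
  exists g, is_cond_prob Z A g.
Proof.
move=> mA; have PA : (P A < +oo)%E.
  by rewrite (le_lt_trans (probability_le1 _ mA))// ltry.
have mZ : measurable_fun setT Z by exact: measurable_funP.
pose nu0 : {charge set T -> \bar R} := charge_of_finite_measure (mfrestr mA PA).
pose nu : {charge set S -> \bar R} :=
  measure_function_pushforward__canonical__charge_Charge nu0 mZ.
have nuE C : nu C = P (A `&` Z @^-1` C) by rewrite setIC.
pose mu := distribution P Z.
have numu : nu `<< mu.
  apply/null_content_dominatesP => C mC muC; rewrite nuE.
  apply/eqP; rewrite eq_le measure_ge0 andbT -[leRHS]muC; apply: le_measure => //.
  - by rewrite inE; apply: measurableI => //; exact: measurable_funPTI.
  - by rewrite inE; exact: measurable_funPTI.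
pose g := Radon_Nikodym nu mu.
exists (fine \o g); have gE : EFin \o (fine \o g) = g.
  by apply/funext => z /=; rewrite fineK// Radon_Nikodym_fin_num.
split; first by rewrite gE; exact: Radon_Nikodym_integrable.
move=> C mC; rewrite -nuE (Radon_Nikodym_integral numu mC).
by apply: eq_integral => z _; rewrite fineK// Radon_Nikodym_fin_num.
Qed.

Lemma cond_probP (A : set T) : measurable A ->
  is_cond_prob Z A (cond_prob Z A).
Proof. by move=> mA; apply: xgetPex; exact: is_cond_prob_exists. Qed.

(** Integrals over all measurable sets determine an integrable function up to a null set. *)
Lemma cond_prob_ae (A : set T) (g : S -> R) : measurable A ->
  is_cond_prob Z A g ->
  {ae distribution P Z, forall z, cond_prob Z A z = g z}.
Proof.
move=> mA [ig gE]; have [ic cE] := cond_probP mA.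
have : ae_eq (distribution P Z) setT (EFin \o cond_prob Z A) (EFin \o g).
  apply: integral_ae_eq => //; first exact: measurable_int ig.
  by move=> E _ mE; rewrite -[LHS]cE// -gE.
by apply: filterS => z /(_ I) [].
Qed.

Lemma is_cond_prob_fine (A : set T) (k : S -> \bar R) :
  measurable_fun setT k -> (forall z, 0 <= k z <= 1)%E ->
  (forall C, measurable C ->
    P (A `&` Z @^-1` C) = \int[distribution P Z]_(z in C) k z)%E ->
  is_cond_prob Z A (fine \o k).
Proof.
move=> mk k01 kE; have kfin z : k z \is a fin_num.
  by have /andP[k0 k1] := k01 z; rewrite ge0_fin_numE// (le_lt_trans k1)// ltry.
split; last first.
  move=> C mC; rewrite kE//; apply: eq_integral => z _ /=.
  by rewrite fineK.
apply: (@probability_bounded_integrable _ _ _ _ _ 1).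
  exact: measurableT_comp (fine_measurable measurableT) mk.
move=> z; have /andP[k0 k1] := k01 z; rewrite ger0_norm ?fine_ge0//.
by rewrite -lee_fin fineK.
Qed.

End cond_prob_theory.

(** * The conditional law of a signal with independent additive noise *)

Section shift_kernel.
Context dU dS (U : measurableType dU) (S : measurableType dS) (R : realType).
Variables (L : probability U R) (f : {mfun S >-> R}) (q : {mfun U >-> R}).

Lemma measurable_shift (x : S) : measurable_fun setT (fun u => f x + q u).
Proof. by apply: measurable_funD. Qed.

(** The conditional law of [f(X) + eps] given [X = x]. The noise enters through any representation
    [q] of its law on a space [L], so that quantiles on the unit interval can replace the original
    noise. *)
Definition shift_kernel (x : S) : {measure set R -> \bar R} :=
  distribution L (mfun_of (measurable_shift x)).

Lemma shift_kernelE x B : shift_kernel x B = L ((fun u => f x + q u) @^-1` B).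
Proof. by []. Qed.

Lemma measurable_shift_kernel (B : set R) :
  measurable B -> measurable_fun setT (shift_kernel ^~ B).
Proof.
move=> mB; pose D := [set z : S * U | B (f z.1 + q z.2)].
have mD : measurable D.
  have mh : measurable_fun setT (fun z : S * U => f z.1 + q z.2).
    by apply: measurable_funD; exact: measurableT_comp.
  by rewrite -[D]setTI; exact: mh.
rewrite (_ : shift_kernel ^~ B = L \o xsection D).
  exact: measurable_fun_xsection.
apply/funext => x; rewrite shift_kernelE /=; congr (L _).
by apply/seteqP; split=> u; rewrite /xsection/= inE.
Qed.

HB.instance Definition _ :=
  isKernel.Build _ _ S R R shift_kernel measurable_shift_kernel.

Lemma shift_kernelT x : shift_kernel x setT = 1%E.
Proof. by rewrite shift_kernelE preimage_setT probability_setT. Qed.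

HB.instance Definition _ :=
  Kernel_isProbability.Build _ _ S R R shift_kernel shift_kernelT.

Lemma shift_kernel01 x B : measurable B -> (0 <= shift_kernel x B <= 1)%E.
Proof. by move=> mB; rewrite measure_ge0 probability_le1. Qed.

End shift_kernel.

Section noise.
Context d dU dS (T : measurableType d) (U : measurableType dU)
  (S : measurableType dS) (R : realType).
Variables (P : probability T R) (L : probability U R).
Variables (f : {mfun S >-> R}) (q : {mfun U >-> R}).
Variables (X : {RV P >-> S}) (eps Y : {RV P >-> R}).
Hypotheses (YE : forall w, Y w = f (X w) + eps w)
  (indep : independent_RVs P X eps)
  (epsE : forall A, measurable A -> L (q @^-1` A) = P (eps @^-1` A)).

Local Notation k := (shift_kernel L f q).

(** By independence the pair of [X] and [eps] has a product law. The event is a set [D] for this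
    law; its section at [x] has measure [k x B] if [x] is in [C] and is empty otherwise. *)
Lemma noise_kernelE (B : set R) (C : set S) : measurable B -> measurable C ->
  (P (Y @^-1` B `&` X @^-1` C) = \int[distribution P X]_(x in C) k x B)%E.
Proof.
move=> mB mC.
pose D := [set z : S * R | B (f z.1 + z.2) /\ C z.1].
have mD : measurable D.
  have mh : measurable_fun setT (fun z : S * R => f z.1 + z.2).
    by apply: measurable_funD => //; exact: measurableT_comp.
  rewrite (_ : D = ((fun z : S * R => f z.1 + z.2) @^-1` B) `&` (fst @^-1` C))//.
  by apply: measurableI; rewrite -[X in measurable X]setTI;
    [exact: mh|exact: measurable_fst].
have mXe : measurable_fun setT (fun w => (X w, eps w)).
  exact: measurable_fun_pair.
have -> : Y @^-1` B `&` X @^-1` C = (fun w => (X w, eps w)) @^-1` D.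
  by apply/seteqP; split=> w /=; rewrite YE.
rewrite -[LHS]/(distribution P (mfun_of mXe) D).
rewrite -(@product_measure_unique _ _ _ _ _ (distribution P X) (distribution L q)
  (distribution P (mfun_of mXe)))//; last first.
  by move=> E F mE mF; rewrite [X in (_ * X)%E](epsE mF) -indep.
rewrite [RHS]integral_mkcond; apply: eq_integral => x _ /=.
rewrite patchE; case: ifPn => xC.
  rewrite shift_kernelE /distribution /pushforward; congr (L _).
  apply/seteqP; split=> u; rewrite /xsection/= inE/=; first by case.
  by split=> //; move: xC; rewrite inE.
rewrite (_ : xsection D x = set0) ?measure0//.
apply/seteqP; split=> // u; rewrite /xsection/= inE/= => -[_ xC'].
by move: xC; rewrite notin_setE.
Qed.

Lemma noise_is_cond_prob (B : set R) : measurable B ->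
  is_cond_prob X (Y @^-1` B) (fun x => fine (k x B)).
Proof.
move=> mB; apply: (is_cond_prob_fine (measurable_shift_kernel L f q mB)).
  by move=> x; exact: shift_kernel01.
by move=> C mC; exact: noise_kernelE.
Qed.

End noise.

(** * Existence and uniqueness of the Markov product *)

Section markov_product.
Context d dU dS (T : measurableType d) (U : measurableType dU)
  (S : measurableType dS) (R : realType).
Variables (P : probability T R) (L : probability U R).
Variables (f : {mfun S >-> R}) (q : {mfun U >-> R}).
Variables (X : {RV P >-> S}) (eps Y : {RV P >-> R}).
Hypotheses (YE : forall w, Y w = f (X w) + eps w)
  (indep : independent_RVs P X eps)
  (epsE : forall A, measurable A -> L (q @^-1` A) = P (eps @^-1` A)).

Local Notation k := (shift_kernel L f q).

(** A realisation of the Markov product under [Q]: the coordinates share the signal [f z.1] and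
    carry independent copies of the noise. *)
Definition noisy_pair (z : S * (U * U)) : R * R :=
  (f z.1 + q z.2.1, f z.1 + q z.2.2).

Lemma measurable_noisy_pair : measurable_fun setT noisy_pair.
Proof.
by apply: measurable_fun_pair; apply: measurable_funD;
  repeat apply: measurableT_comp => //.
Qed.

Let Q : probability (S * (U * U))%type R := (distribution P X \x (L \x L))%E.

(** The section at a point of [D] is a rectangle, whose measure under [L \x L] factors. This is
    conditional independence in integrated form. *)
Lemma noisy_pairE (B C : set R) (D : set S) :
  measurable B -> measurable C -> measurable D ->
  (Q (noisy_pair @^-1` (B `*` C) `&` fst @^-1` D) =
   \int[distribution P X]_(x in D) (k x B * k x C))%E.
Proof.
move=> mB mC mD; rewrite [RHS]integral_mkcond.
rewrite -[LHS]/(\int[distribution P X]_x _)%E; apply: eq_integral => x _ /=.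
rewrite patchE; case: ifPn => xD.
  rewrite !shift_kernelE -product_measure1E; last 2 first.
  - by rewrite -[X in measurable X]setTI; exact: measurable_shift.
  - by rewrite -[X in measurable X]setTI; exact: measurable_shift.
  congr (_ _); apply/seteqP; split=> u; rewrite /xsection/= inE/=; first by case.
  by split=> //; move: xD; rewrite inE.
rewrite (_ : xsection _ x = set0) ?measure0//.
apply/seteqP; split=> // u; rewrite /xsection/= inE/= => -[_ xD'].
by move: xD; rewrite notin_setE.
Qed.

Lemma markov_product_exists : exists nu, is_markov_product Y X nu.
Proof.
pose V := mfun_of measurable_noisy_pair.
have mY1 : measurable_fun setT (fst \o noisy_pair).
  exact: measurableT_comp measurable_fst measurable_noisy_pair.
have mY2 : measurable_fun setT (snd \o noisy_pair).
  exact: measurableT_comp measurable_snd measurable_noisy_pair.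
pose Y1 := mfun_of mY1 : {RV Q >-> R}; pose Y2 := mfun_of mY2 : {RV Q >-> R}.
pose Z := mfun_of (@measurable_fst _ _ S (U * U)%type) : {RV Q >-> S}.
have ZE (D : set S) (g : S -> \bar R) :
    (\int[distribution Q Z]_(x in D) g x = \int[distribution P X]_(x in D) g x)%E.
  apply: eq_measure_integral => E mE _.
  rewrite [LHS](_ : _ = Q (E `*` setT)); last by rewrite setXT.
  rewrite [LHS]product_measure1E//.
  by rewrite [X in (_ * X)%E]probability_setT mule1.
(* Each coordinate has conditional law [k]: let the set constraining the other one be the whole
   line. *)
have Y1E (B : set R) (D : set S) : measurable B -> measurable D ->
    (Q (Y1 @^-1` B `&` Z @^-1` D) = \int[distribution Q Z]_(x in D) k x B)%E.
  move=> mB mD; rewrite ZE; have := noisy_pairE mB measurableT mD.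
  under eq_integral do rewrite shift_kernelT mule1.
  by move=> <-; congr (_ _); apply/seteqP; split=> w /=; tauto.
have Y2E (B : set R) (D : set S) : measurable B -> measurable D ->
    (Q (Y2 @^-1` B `&` Z @^-1` D) = \int[distribution Q Z]_(x in D) k x B)%E.
  move=> mB mD; rewrite ZE; have := noisy_pairE measurableT mB mD.
  under eq_integral do rewrite shift_kernelT mul1e.
  by move=> <-; congr (_ _); apply/seteqP; split=> w /=; tauto.
exists (distribution Q V), _, _, Q, Y1, Y2, Z; split => //.
- move=> A mA.
  have mYX : measurable_fun setT (fun w => (Y w, X w)).
    exact: measurable_fun_pair.
  have mYZ : measurable_fun setT (fun w => (Y1 w, Z w)).
    exact: measurable_fun_pair.
  apply: (measure_prod_unique (m1 := distribution Q (mfun_of mYZ))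
    (m2 := distribution P (mfun_of mYX))) mA => B D mB mD.
  rewrite -[LHS]/(Q (Y1 @^-1` B `&` Z @^-1` D)).
  rewrite -[RHS]/(P (Y @^-1` B `&` X @^-1` D)).
  by rewrite Y1E// ZE -(noise_kernelE YE indep epsE).
- split.
    exists k, k; split; [exact: Y1E|exact: Y2E|].
    by apply: aeW => x B _.
  have cpE (B : set R) (W : {RV Q >-> R}) : measurable B ->
      (forall D, measurable D ->
        Q (W @^-1` B `&` Z @^-1` D) = \int[distribution Q Z]_(x in D) k x B)%E ->
      {ae distribution Q Z, forall x, cond_prob Z (W @^-1` B) x = fine (k x B)}.
    move=> mB WE; apply: cond_prob_ae; first exact: measurable_funPTI.
    apply: (is_cond_prob_fine (measurable_shift_kernel L f q mB)) => // x.
    exact: shift_kernel01.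
  move=> B C mB mC.
  have c12 : {ae distribution Q Z, forall x,
      cond_prob Z (Y1 @^-1` B `&` Y2 @^-1` C) x = fine (k x B * k x C)}.
    apply: cond_prob_ae.
      by apply: measurableI; exact: measurable_funPTI.
    apply: is_cond_prob_fine.
    + apply: emeasurable_funM; exact: measurable_shift_kernel.
    + move=> x; have /andP[B0 B1] := shift_kernel01 L f q x mB.
      have /andP[C0 C1] := shift_kernel01 L f q x mC.
      by rewrite mule_ge0//= -[leRHS]mule1 lee_pmul.
    + by move=> D mD; rewrite ZE -noisy_pairE.
  apply: filterS3 c12 (cpE B Y1 mB (Y1E B ^~ mB)) (cpE C Y2 mC (Y2E C ^~ mC)).
  move=> x -> -> ->; rewrite fineM// ge0_fin_numE//;
    (have /andP[_ k1] := shift_kernel01 L f q x mB);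
    (have /andP[_ k2] := shift_kernel01 L f q x mC);
    by rewrite (le_lt_trans _ (ltry 1)).
Qed.

(** On a rectangle, conditional independence turns the conditional probability into a product of two
    factors. Both are values of [k], and integrating the product gives [noisy_pairE]. *)
Lemma markov_productE (nu : probability (R * R)%type R) :
  is_markov_product Y X nu ->
  forall A, measurable A -> nu A = Q (noisy_pair @^-1` A).
Proof.
move=> [d' [T' [Q' [Y1 [Y2 [Z [YZE [[k1 [k2 [k1E k2E k12]]] cind] nuE]]]]]]].
apply: (measure_prod_unique
  (m2 := distribution Q (mfun_of measurable_noisy_pair))).
move=> B C mB mC; rewrite nuE; last exact: measurableX.
rewrite -[LHS]/(Q' (Y1 @^-1` B `&` Y2 @^-1` C)).
rewrite -[RHS]/(Q (noisy_pair @^-1` (B `*` C))).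
rewrite -[noisy_pair @^-1` _]setIT -[setT in RHS](preimage_setT fst).
rewrite noisy_pairE//.
have ZE (D : set S) (g : S -> \bar R) :
    (\int[distribution Q' Z]_(x in D) g x = \int[distribution P X]_(x in D) g x)%E.
  apply: eq_measure_integral => E mE _.
  by have := YZE (setT `*` E) (measurableX measurableT mE); rewrite !setTX.
have Y1E (E : set R) (D : set S) : measurable E -> measurable D ->
    (Q' (Y1 @^-1` E `&` Z @^-1` D) = \int[distribution Q' Z]_(x in D) k x E)%E.
  move=> mE mD; rewrite ZE -(noise_kernelE YE indep epsE)//.
  exact: (YZE (E `*` D) (measurableX mE mD)).
(* The first copy has kernel [k] because its joint law with [Z] is that of [Y] and [X]; almost
   everywhere equality of [k1] and [k2] passes this on to the second copy. *)
have Y2E (E : set R) (D : set S) : measurable E -> measurable D ->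
    (Q' (Y2 @^-1` E `&` Z @^-1` D) = \int[distribution Q' Z]_(x in D) k x E)%E.
  move=> mE mD; rewrite -Y1E// k1E// k2E//; apply: ae_eq_integral => //.
  - exact/measurable_funTS/measurable_kernel.
  - exact/measurable_funTS/measurable_kernel.
  - by apply: filterS k12 => x k12x _; rewrite k12x.
have cpE (E : set R) (W : {RV Q' >-> R}) : measurable E ->
    (forall D, measurable D ->
      Q' (W @^-1` E `&` Z @^-1` D) = \int[distribution Q' Z]_(x in D) k x E)%E ->
    {ae distribution Q' Z, forall x, cond_prob Z (W @^-1` E) x = fine (k x E)}.
  move=> mE WE; apply: cond_prob_ae; first exact: measurable_funPTI.
  apply: (is_cond_prob_fine (measurable_shift_kernel L f q mE)) => // x.
  exact: shift_kernel01.
have mBC : measurable (Y1 @^-1` B `&` Y2 @^-1` C).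
  by apply: measurableI; exact: measurable_funPTI.
have [ic cE] := cond_probP Z mBC.
rewrite -[Y1 @^-1` B `&` _]setIT -[setT in LHS](preimage_setT Z) cE// -ZE.
apply: ae_eq_integral => //.
- exact: measurable_int ic.
- apply: emeasurable_funM; exact: measurable_shift_kernel.
- apply: filterS3 (cind B C mB mC) (cpE B Y1 mB (Y1E B ^~ mB))
    (cpE C Y2 mC (Y2E C ^~ mC)).
  move=> x -> -> -> _; rewrite EFinM !fineK// ge0_fin_numE//;
    (have /andP[_ l1] := shift_kernel01 L f q x mB);
    (have /andP[_ l2] := shift_kernel01 L f q x mC);
    by rewrite (le_lt_trans _ (ltry 1)).
Qed.

End markov_product.

(** * Variances of bounded variables *)

Section bounded_variance.
Context d (T : measurableType d) (R : realType) (P : probability T R).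
Implicit Types h : T -> R.

Lemma expectation_ae h1 h2 :
  measurable_fun setT h1 -> measurable_fun setT h2 ->
  {ae P, forall w, h1 w = h2 w} -> ('E_P[h1] = 'E_P[h2])%E.
Proof.
move=> m1 m2 h12; rewrite unlock; apply: ae_eq_integral => //.
- exact/measurable_EFinP.
- exact/measurable_EFinP.
- by apply: filterS h12 => w /= -> _.
Qed.

Lemma variance_ae h1 h2 :
  measurable_fun setT h1 -> measurable_fun setT h2 ->
  {ae P, forall w, h1 w = h2 w} -> ('V_P[h1] = 'V_P[h2])%E.
Proof.
move=> m1 m2 h12.
rewrite /variance !covariance.unlock (expectation_ae m1 m2 h12).
apply: expectation_ae.
- by apply: measurable_funM; apply: measurable_funB => //; exact: measurable_cst.
- by apply: measurable_funM; apply: measurable_funB => //; exact: measurable_cst.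
- by apply: filterS h12 => w h12w; rewrite /GRing.mul/= h12w.
Qed.

Lemma variance_bounded h (M : R) : measurable_fun setT h ->
  (forall w, `|h w| <= M) ->
  ('V_P[h] = (\int[P]_w (h w ^+ 2) - (\int[P]_w h w) ^+ 2)%:E)%E.
Proof.
move=> mh hM; have ih := probability_bounded_integrable P mh hM.
have h2M w : `|h w ^+ 2| <= M ^+ 2.
  by rewrite normrX lerXn2r// nnegrE (le_trans _ (hM w)).
have mh2 : measurable_fun setT (fun w => h w ^+ 2) by exact: measurable_funX.
have ih2 := probability_bounded_integrable P mh2 h2M.
rewrite /variance covarianceE; [|exact/Lfun1_integrable..|]; last first.
  by apply/Lfun1_integrable; rewrite (_ : h * h = (fun w => h w ^+ 2)).
rewrite unlock EFinB EFin_expe /Rintegral !fineK//;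
  exact: integrable_fin_num.
Qed.

End bounded_variance.

(** * Tail functions and their moments under a random shift *)

Section tail.
Context (R : realType) (nu : probability R R).

Definition tail (t : R) : R := fine (nu `[t, +oo[%classic).

Lemma tail01 t : 0 <= tail t <= 1.
Proof.
rewrite fine_ge0//= -lee_fin fineK ?probability_le1//.
by rewrite fin_num_measure.
Qed.

Lemma tail_nonincreasing : nonincreasing_fun tail.
Proof.
move=> s t st; rewrite fine_le ?fin_num_measure//.
by rewrite le_measure ?inE//; apply: subset_itvr; rewrite bnd_simp.
Qed.

Lemma measurable_tail : measurable_fun setT tail.
Proof. exact: nonincreasing_measurable tail_nonincreasing. Qed.

End tail.

Section tail_moment.
Context (R : realType) (rho nu : probability R R).

(* If Z and e are independent with laws rho and nu, then this is the m-th
   moment of P(Z + e >= y | Z). *)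
Definition tail_moment (m : nat) (y : R) : R :=
  \int[rho]_z (tail nu (y - z)) ^+ m.

Lemma measurable_tail_moment_integrand m (y : R) :
  measurable_fun setT (fun z : R => tail nu (y - z) ^+ m).
Proof.
apply: measurable_funX; apply: measurableT_comp; first exact: measurable_tail.
exact: measurable_funB.
Qed.

Lemma tail_exp01 m t : 0 <= tail nu t ^+ m <= 1.
Proof. by have /andP[t0 t1] := tail01 nu t; rewrite exprn_ge0//= exprn_ile1. Qed.

Lemma norm_tail_exp m t : `|tail nu t ^+ m| <= 1.
Proof. by have /andP[t0 t1] := tail_exp01 m t; rewrite ger0_norm. Qed.

Lemma integrable_tail_moment m y :
  rho.-integrable setT (EFin \o (fun z : R => tail nu (y - z) ^+ m)).
Proof.
apply: probability_bounded_integrable (measurable_tail_moment_integrand m y) _.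
by move=> z; exact: norm_tail_exp.
Qed.

Lemma tail_moment01 m y : 0 <= tail_moment m y <= 1.
Proof.
apply/andP; split.
  by apply: Rintegral_ge0 => z _; have /andP[] := tail_exp01 m (y - z).
rewrite (_ : 1 = \int[rho]_z (cst 1 z)); last first.
  by rewrite Rintegral_cst// [X in fine X]probability_setT mulr1.
apply: le_Rintegral => //; first exact: integrable_tail_moment.
  apply: (@probability_bounded_integrable _ _ _ _ _ 1) => //.
  by move=> z; rewrite normr1.
by move=> z _; have /andP[] := tail_exp01 m (y - z).
Qed.

(** Powers of the nonnegative nonincreasing [tail] are nonincreasing, hence so is the integral in
    [y], and monotone functions are measurable. *)
Lemma measurable_tail_moment m : measurable_fun setT (tail_moment m).
Proof.
apply: nonincreasing_measurable => // s t st.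
apply: le_Rintegral => //; [exact: integrable_tail_moment..|].
move=> z _; apply: lerXn2r; rewrite ?nnegrE;
  try by case/andP: (tail01 nu (s - z)); case/andP: (tail01 nu (t - z)).
by apply: tail_nonincreasing; rewrite lerD2r.
Qed.

(* Var(P(Z + e >= y | Z)) for m = 2 and Var(1_{Z + e >= y}) for m = 1. *)
Definition tail_variance (m : nat) (y : R) : R :=
  tail_moment m y - tail_moment 1 y ^+ 2.

Lemma measurable_tail_variance m : measurable_fun setT (tail_variance m).
Proof.
apply: measurable_funB; first exact: measurable_tail_moment.
by apply: measurable_funX; exact: measurable_tail_moment.
Qed.

Lemma norm_tail_variance m y : `|tail_variance m y| <= 1.
Proof.
have /andP[m0 m1] := tail_moment01 m y.
have /andP[n0 n1] := tail_moment01 1 y.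
have n20 : 0 <= tail_moment 1 y ^+ 2 by exact: sqr_ge0.
have n21 : tail_moment 1 y ^+ 2 <= 1 by rewrite exprn_ile1.
by rewrite ler_norml; apply/andP; split; rewrite /tail_variance; lra.
Qed.

End tail_moment.

Lemma tail_shift_kernel dU dS (U : measurableType dU) (S : measurableType dS)
    (R : realType) (L : probability U R) (f : {mfun S >-> R})
    (q : {mfun U >-> R}) (y : R) (x : S) :
  fine (shift_kernel L f q x `[y, +oo[%classic) =
  tail (distribution L q) (y - f x).
Proof.
rewrite shift_kernelE /tail; congr (fine (L _)); apply/seteqP.
by split=> u /=; rewrite !in_itv/= !andbT lerBlDl.
Qed.

(** * Chatterjee's coefficient in terms of tail moments *)

Section xi_formula.
Context d dU dS (T : measurableType d) (U : measurableType dU)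
  (S : measurableType dS) (R : realType).
Variables (P : probability T R) (L : probability U R).
Variables (f : {mfun S >-> R}) (q : {mfun U >-> R}).
Variables (X : {RV P >-> S}) (fX eps Y : {RV P >-> R}).
Hypotheses (fXE : forall w, fX w = f (X w))
  (YE : forall w, Y w = f (X w) + eps w)
  (X_eps : independent_RVs P X eps)
  (fX_eps : independent_RVs P fX eps)
  (epsE : forall A, measurable A -> L (q @^-1` A) = P (eps @^-1` A)).

Let rho : probability R R := distribution P fX.
Let nu : probability R R := distribution L q.
(** With the identity as signal function, [fX] itself can serve as the conditioning variable. *)
Let idR : {mfun R >-> R} := mfun_of (@measurable_id _ R setT).

Let prob_Y (B : set R) : measurable B ->
  (P (Y @^-1` B) = \int[rho]_z shift_kernel L idR q z B)%E.
Proof.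
move=> mB; have YE' w : Y w = idR (fX w) + eps w by rewrite YE fXE.
have := @noise_kernelE _ _ _ _ _ _ _ P L idR q fX eps Y YE' fX_eps epsE B setT
  mB measurableT.
by rewrite preimage_setT setIT.
Qed.

Lemma law_noise (B : set R) : measurable B ->
  (rho \x L)%E ((fun z => z.1 + q z.2) @^-1` B) = distribution P Y B.
Proof.
move=> mB; rewrite [RHS](prob_Y mB); apply: eq_integral => z _.
rewrite shift_kernelE /=; congr (L _).
by apply/seteqP; split=> u; rewrite /xsection/= inE.
Qed.

Lemma tail_YE y : tail (distribution P Y) y = tail_moment rho nu 1 y.
Proof.
rewrite /tail [X in fine X](prob_Y (measurable_itv _)).
rewrite /tail_moment /Rintegral; congr fine; apply: eq_integral => z _.
rewrite expr1 -(tail_shift_kernel L idR q) fineK//.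
by rewrite ge0_fin_numE// (le_lt_trans (probability_le1 _ _))// ltry.
Qed.

(** An indicator equals its square, so both of its moments are the probability of [Y >= y]. *)
Lemma variance_tail y :
  ('V_P[\1_(Y @^-1` `[y, +oo[)] = (tail_variance rho nu 1 y)%:E)%E.
Proof.
have mA : measurable (Y @^-1` `[y, +oo[) by exact: measurable_funPTI.
rewrite (@variance_bounded _ _ _ P _ 1) //; last first.
  by move=> w; rewrite indicE; case: (_ \in _); rewrite ?normr1 ?normr0.
have -> : (fun w => \1_(Y @^-1` `[y, +oo[) w ^+ 2) =
    \1_(Y @^-1` `[y, +oo[) :> (T -> R).
  by apply/funext => w; rewrite indicE; case: (_ \in _);
    rewrite ?expr1n ?expr0n.
have -> : \int[P]_w \1_(Y @^-1` `[y, +oo[) w = tail_moment rho nu 1 y.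
  by rewrite /Rintegral integral_indic// setIT -tail_YE.
by [].
Qed.

(** Since [X] and [eps] are independent, [tail nu (y - f x)] is a version of the conditional
    probability given [X = x]. It depends on [x] through [f x] only, so its moments are integrals
    against [rho]. *)
Lemma variance_cond_tail y :
  ('V_P[cond_prob X (Y @^-1` `[y, +oo[) \o X] =
   (tail_variance rho nu 2 y)%:E)%E.
Proof.
have mA : measurable (Y @^-1` `[y, +oo[) by exact: measurable_funPTI.
have mG : measurable_fun setT (fun w => tail nu (y - fX w)).
  apply: measurableT_comp; first exact: measurable_tail.
  exact: measurable_funB.
rewrite (@variance_ae _ _ _ P _ (fun w => tail nu (y - fX w)))//; last 2 first.
- have [ic _] := cond_probP X mA; apply: measurableT_comp => //.
  exact/measurable_EFinP/(measurable_int _ ic).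
(* Equality almost everywhere for the law of [X] is carried over to [P]. *)
- have := @ae_preimage _ _ _ _ _ P (distribution P X) X (measurable_funP X)
    (fun _ _ => erefl) _
    (cond_prob_ae mA (noise_is_cond_prob YE X_eps epsE (measurable_itv _))).
  by apply: filterS => w /= ->; rewrite tail_shift_kernel fXE.
have E m : \int[P]_w (tail nu (y - fX w) ^+ m) = tail_moment rho nu m y.
  rewrite /tail_moment /Rintegral; congr fine; apply/esym.
  apply: (@integral_preimage _ _ _ _ _ P rho fX (measurable_funP fX)) => //.
    exact: measurable_tail_moment_integrand.
  exists 1; split=> [|K K1 z _]; first exact: num_real.
  exact: le_trans (norm_tail_exp _ _ _) (ltW K1).
rewrite (@variance_bounded _ _ _ P _ 1)//; last first.
  by move=> w; have := norm_tail_exp nu 1 (y - fX w); rewrite expr1.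
have E1 : \int[P]_w tail nu (y - fX w) = tail_moment rho nu 1 y := E 1%N.
by rewrite E E1.
Qed.

Lemma xi_noise : xi Y X =
  (\int[(rho \x L)%E]_z tail_variance rho nu 2 (z.1 + q z.2)) /
  (\int[(rho \x L)%E]_z tail_variance rho nu 1 (z.1 + q z.2)).
Proof.
have mz : measurable_fun setT (fun z : R * U => z.1 + q z.2).
  by apply: measurable_funD => //; exact: measurableT_comp.
have E m : (\int[distribution P Y]_y (tail_variance rho nu m y)%:E =
    \int[(rho \x L)%E]_z (tail_variance rho nu m (z.1 + q z.2))%:E)%E.
  apply: (@integral_preimage _ _ _ _ _ (rho \x L)%E (distribution P Y) _ mz
    law_noise); first exact: measurable_tail_variance.
  exists 1; split=> [|K K1 z _]; first exact: num_real.
  exact: le_trans (norm_tail_variance _ _ _ _) (ltW K1).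
rewrite /xi /Rintegral -!E; congr (fine _ / fine _).
- by apply: eq_integral => y _; rewrite variance_cond_tail.
- by apply: eq_integral => y _; rewrite variance_tail.
Qed.

End xi_formula.

(** * Positivity of the denominator *)

Section tail_positive.
Context (R : realType) (nu : probability R R).
Hypothesis tail_cont : continuous (tail nu).

(** By continuity the tail takes the value 1/2 at some [m] and 1/4 at some [c >= m]. The interval
    from [m] to [c] has mass 1/2 - 1/4 = 1/4, and the integrand is bounded away from 0 on it. *)
Lemma tail_variance_gt0 : 0 < \int[nu]_y (tail nu y - tail nu y ^+ 2).
Proof.
pose Y : {RV nu >-> R} := mfun_of (@measurable_id _ R setT).
have rayE y : nu `]y, +oo[%classic = (1 - cdf Y y)%E.
  by rewrite -setCitvl probability_setC.
have [a ta] : exists a, 1 / 2 <= tail nu a.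
  have /near_lt_cvge/(_ (ltac:(by rewrite lte_fin; lra) : (0 < (1/2)%:E)%E)) :=
    @cvg_cdfNy0 _ _ _ nu Y.
  move=> /filter_ex[a Fa]; exists a.
  rewrite -lee_fin /tail fineK ?fin_num_measure//.
  apply: (@le_trans _ _ (nu `]a, +oo[%classic)).
    rewrite rayE -[cdf Y a]fineK ?fin_num_measure// -EFinB lee_fin.
    by move: Fa; rewrite -[cdf Y a]fineK ?fin_num_measure// lte_fin; lra.
  by rewrite le_measure ?inE//; apply: subset_itvr; rewrite bnd_simp.
have [b tb] : exists b, tail nu b <= 1 / 4.
  have /near_gt_cvge/(_ (ltac:(by rewrite lte_fin; lra) : ((3/4)%:E < 1)%E)) :=
    @cvg_cdfy1 _ _ _ nu Y.
  (* Moving to [b + 1] puts the closed ray of [tail] inside the open ray above [b], whose mass is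
     below 1/4. *)
  move=> /filter_ex[b Fb]; exists (b + 1).
  rewrite -lee_fin /tail fineK ?fin_num_measure//.
  apply: (@le_trans _ _ (nu `]b, +oo[%classic)).
    by rewrite le_measure ?inE//; apply: subset_itvr; rewrite bnd_simp ltrDl.
  rewrite rayE -[cdf Y b]fineK ?fin_num_measure// -EFinB lee_fin.
  by move: Fb; rewrite -[cdf Y b]fineK ?fin_num_measure// lte_fin; lra.
have ab : a <= b.
  rewrite leNgt; apply/negP => /ltW/(tail_nonincreasing nu); lra.
have tail_ivt v c : c <= b -> tail nu b <= v <= tail nu c ->
    exists2 x, c <= x <= b & tail nu x = v.
  move=> cb vbc; have [||x] := @IVT R (tail nu) c b v cb.
  - exact: continuous_subspaceT.
  - by rewrite minC (min_idPl _) ?(max_idPl _)//; apply: tail_nonincreasing.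
  - by rewrite in_itv/=; exists x.
have [|m /andP[am mb] tm] := tail_ivt (1 / 2) a ab.
  by apply/andP; split; lra.
have [|c /andP[mc cb] tc] := tail_ivt (1 / 4) m mb.
  by apply/andP; split; lra.
have mtail := measurable_tail nu.
have tail_bnd y := tail01 nu y.
(* For t between 1/4 and 1/2, t - t^2 is at least 3/16, hence at least 1/8. *)
pose g (y : R) : R := (1 / 8) * \1_(`[m, c[) y.
have ig : nu.-integrable setT (EFin \o g).
  apply: (@probability_bounded_integrable _ _ _ _ _ 1).
    by apply: measurable_funM => //; exact: measurable_indic.
  by move=> y; rewrite /g indicE; case: (_ \in _); rewrite ger0_norm/=; lra.
apply: (@lt_le_trans _ _ (\int[nu]_y g y)).
  rewrite RintegralZl//; last first.
    apply: (@probability_bounded_integrable _ _ _ _ _ 1) => //.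
    by move=> y; rewrite indicE; case: (_ \in _); rewrite ?normr1 ?normr0.
  rewrite /Rintegral integral_indic// setIT.
  have -> : `[m, c[%classic = `[m, +oo[%classic `\` `[c, +oo[%classic :> set R.
    apply/seteqP; split=> y /=; rewrite !in_itv/= !andbT.
      by move=> /andP[-> yc]; split => //; rewrite leNgt yc.
    by move=> [-> /negP]; rewrite -ltNge.
  rewrite measureD//; last by rewrite (le_lt_trans (probability_le1 _ _))// ltry.
  rewrite setIidr; last by apply: subset_itvr; rewrite bnd_simp.
  rewrite fineB ?fin_num_measure// -/(tail nu m) -/(tail nu c) tm tc; lra.
apply: le_Rintegral => //.
  apply: (@probability_bounded_integrable _ _ _ _ _ 1).
    by apply: measurable_funB => //; exact: measurable_funX.
  move=> y; have /andP[t0 t1] := tail_bnd y.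
  by rewrite ler_norml; apply/andP; split; nra.
move=> y _; rewrite /g indicE; have /andP[t0 t1] := tail_bnd y.
case: (boolP (y \in _)) => [|_]; last by rewrite mulr0; nra.
rewrite inE/= in_itv/= => /andP[my yc] /=.
have := tail_nonincreasing nu my; have := tail_nonincreasing nu (ltW yc).
rewrite tm tc => h1 h2; nra.
Qed.

End tail_positive.

(** * Convergence of tails and of their moments along moving points *)

Lemma cvg_indic_itvcy (R : realType) (x_ t_ : nat -> R) (x t : R) :
  x_ n @[n --> \oo] --> x -> t_ n @[n --> \oo] --> t -> x != t ->
  (\1_(`[t_ n, +oo[) (x_ n) : R) @[n --> \oo] --> (\1_(`[t, +oo[) x : R).
Proof.
move=> x_x t_t xt; have d_d : x_ n - t_ n @[n --> \oo] --> x - t by exact: cvgB.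
apply: cvg_near_cst; rewrite indicE mem_setE in_itv/= andbT.
have [tx|xt'|e] := ltgtP t x; last by rewrite e eqxx in xt.
- have xt0 : 0 < x - t by rewrite subr_gt0.
  apply: filterS (cvgr_gt _ d_d _ xt0) => n; rewrite subr_gt0 => tn.
  by rewrite indicE mem_setE in_itv/= andbT ltW.
- have xt0 : x - t < 0 by rewrite subr_lt0.
  apply: filterS (cvgr_lt _ d_d _ xt0) => n; rewrite subr_lt0 => tn.
  by rewrite indicE mem_setE in_itv/= andbT leNgt tn.
Qed.

Section ae_product.
Context d1 d2 (T1 : measurableType d1) (T2 : measurableType d2) (R : realType).
Variables (m1 : probability T1 R) (m2 : probability T2 R).
Let m : probability (T1 * T2)%type R := (m1 \x m2)%E.

Lemma ae_fst (Q : T1 -> Prop) :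
  {ae m1, forall x, Q x} -> {ae m, forall z, Q z.1}.
Proof.
apply: (@ae_preimage _ _ _ _ _ m m1 fst measurable_fst) => A mA.
rewrite -setXT [LHS]product_measure1E//.
by rewrite [X in (_ * X)%E]probability_setT mule1.
Qed.

Lemma ae_snd (Q : T2 -> Prop) :
  {ae m2, forall x, Q x} -> {ae m, forall z, Q z.2}.
Proof.
apply: (@ae_preimage _ _ _ _ _ m m2 snd measurable_snd) => A mA.
rewrite -setTX [LHS]product_measure1E//.
by rewrite [X in (X * _)%E]probability_setT mul1e.
Qed.

End ae_product.

Lemma cvg_exprn (R : realType) (u_ : nat -> R) (u : R) m :
  u_ n @[n --> \oo] --> u -> u_ n ^+ m @[n --> \oo] --> u ^+ m.
Proof. by move=> u_u; exact: (cvg_comp _ _ u_u (@exprn_continuous R m u)). Qed.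

Section tail_convergence.
Context dU (U : measurableType dU) (R : realType).
Variables (rho : probability R R) (L : probability U R).
Variables (q_ : nat -> {mfun U >-> R}) (q : {mfun U >-> R}).
Hypotheses (rho_atomless : forall x, rho [set x] = 0%E)
  (q_q : {ae L, forall u, q_ n u @[n --> \oo] --> q u}).

Let nu_ n : probability R R := distribution L (q_ n).
Let nu : probability R R := distribution L q.

Let tail_integral (h : {mfun U >-> R}) t :
  tail (distribution L h) t = \int[L]_u \1_(`[t, +oo[) (h u).
Proof.
rewrite /tail /Rintegral.
rewrite (eq_integral (fun u => (\1_(h @^-1` `[t, +oo[) u)%:E))//.
by rewrite integral_indic ?setIT//; exact: measurable_funPTI.
Qed.

(** Write the tails as integrals of indicators over [L]. Where [q u] differs from [t] the indicators
    are eventually constant, and the exceptional set is null as [t] is not an atom. *)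
Lemma cvg_tail (t_ : nat -> R) (t : R) : L (q @^-1` [set t]) = 0%E ->
  t_ n @[n --> \oo] --> t -> tail (nu_ n) (t_ n) @[n --> \oo] --> tail nu t.
Proof.
move=> qt0 t_t; rewrite /nu tail_integral.
rewrite (_ : (fun n => _) =
    (fun n => \int[L]_u \1_(`[t_ n, +oo[) (q_ n u))); last first.
  by apply/funext => n; rewrite tail_integral.
have mi (h : {mfun U >-> R}) s :
    measurable_fun setT (fun u => \1_(`[s, +oo[) (h u) : R).
  by apply: measurableT_comp => //; exact: measurable_indic.
have i1 (s x : R) : `|\1_(`[s, +oo[) x| <= 1 :> R.
  by rewrite indicE; case: (_ \in _); rewrite ?normr1 ?normr0.
apply: (@bounded_convergence_R _ _ _ L _ _ 1) => //.
have qt : {ae L, forall u, q u != t}.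
  exists (q @^-1` [set t]); split => //.
  by move=> u /= /negP; rewrite negbK => /eqP.
by apply: filterS2 q_q qt => u qu qut; exact: cvg_indic_itvcy.
Qed.

(** Tonelli for the set of pairs with [z + q u = y]: its sections at fixed [u] are single points,
    null for the atomless [rho], so its sections at fixed [z] are [L]-null for almost every [z]. *)
Lemma ae_shift_atomless (y : R) :
  {ae rho, forall z, L (q @^-1` [set y - z]) = 0%E}.
Proof.
pose D := [set w : R * U | w.1 + q w.2 = y].
have mD : measurable D.
  have mh : measurable_fun setT (fun w : R * U => w.1 + q w.2).
    by apply: measurable_funD => //; exact: measurableT_comp.
  by rewrite -[D]setTI; exact: mh measurableT _ (measurable_set1 y).
have xD z : xsection D z = q @^-1` [set y - z].
  apply/seteqP; split=> u; rewrite /xsection/= inE /D/= => h; lra.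
have yD u : ysection D u = [set y - q u].
  apply/seteqP; split=> z; rewrite /ysection/= inE /D/= => h; lra.
have I0 : (\int[rho]_z (L \o xsection D) z = 0)%E.
  rewrite -indic_fubini_tonelli_FE// indic_fubini_tonelli//.
  rewrite indic_fubini_tonelli_GE// integral0_eq// => u _ /=.
  by rewrite yD.
have mL : measurable_fun setT (L \o xsection D).
  exact: measurable_fun_xsection.
have /(ae_eq_integral_abs _ measurableT mL) :
    (\int[rho]_z `|(L \o xsection D) z| = 0)%E.
  by rewrite -[RHS]I0; apply: eq_integral => z _; rewrite gee0_abs.
by apply: filterS => z /(_ I) /=; rewrite xD.
Qed.

(** The limiting noise may have atoms, but [y - z] avoids them for almost every [z]; [cvg_tail] and
    bounded convergence then apply. *)
Lemma cvg_tail_moment m (y_ : nat -> R) (y : R) : y_ n @[n --> \oo] --> y ->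
  tail_moment rho (nu_ n) m (y_ n) @[n --> \oo] --> tail_moment rho nu m y.
Proof.
move=> y_y; apply: (@bounded_convergence_R _ _ _ rho _ _ 1).
- by move=> n; exact: measurable_tail_moment_integrand.
- exact: measurable_tail_moment_integrand.
- by move=> n z; exact: norm_tail_exp.
- apply: filterS (ae_shift_atomless y) => z Lz.
  apply: cvg_exprn; apply: cvg_tail => //; apply: cvgB => //; exact: cvg_cst.
- by move=> z; exact: norm_tail_exp.
Qed.

Lemma cvg_tail_variance m (y_ : nat -> R) (y : R) : y_ n @[n --> \oo] --> y ->
  tail_variance rho (nu_ n) m (y_ n) @[n --> \oo] --> tail_variance rho nu m y.
Proof.
move=> y_y; apply: cvgB; first exact: cvg_tail_moment.
by apply: cvg_exprn; exact: cvg_tail_moment.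
Qed.

Lemma cvg_integral_tail_variance m :
  \int[(rho \x L)%E]_z tail_variance rho (nu_ n) m (z.1 + q_ n z.2)
    @[n --> \oo] -->
  \int[(rho \x L)%E]_z tail_variance rho nu m (z.1 + q z.2).
Proof.
have mz (h : {mfun U >-> R}) :
    measurable_fun setT (fun z : R * U => z.1 + h z.2).
  by apply: measurable_funD => //; exact: measurableT_comp.
apply: (@bounded_convergence_R _ _ _ (rho \x L)%E _ _ 1).
- by move=> n; apply: measurableT_comp => //; exact: measurable_tail_variance.
- by apply: measurableT_comp => //; exact: measurable_tail_variance.
- by move=> n z; exact: norm_tail_variance.
- apply: filterS (ae_snd rho q_q) => z qz; apply: cvg_tail_variance.
  by apply: cvgD => //; exact: cvg_cst.
- by move=> z; exact: norm_tail_variance.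
Qed.

End tail_convergence.

(** Sequential continuity is [cvg_tail_moment] for a constant sequence of noises. *)
Lemma tail_moment_continuous dU (U : measurableType dU) (R : realType)
    (rho : probability R R) (L : probability U R) (q : {mfun U >-> R}) m :
  (forall x, rho [set x] = 0%E) ->
  continuous (tail_moment rho (distribution L q) m).
Proof.
move=> rho0 y; apply/(@cvg_nbhsP _ R^o) => y_ y_y.
apply: (@cvg_tail_moment _ _ _ rho L (fun=> q)) => //.
by apply: aeW => u; exact: cvg_cst.
Qed.

(** An atom at [x] would keep [cdf X y], for all [y < x], below [cdf X x] by at least its mass,
    against left-continuity. *)
Lemma cdf_continuous_atomless d (T : measurableType d) (R : realType)
    (P : probability T R) (X : {RV P >-> R}) :
  continuous (cdf X) -> forall x, distribution P X [set x] = 0%E.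
Proof.
move=> cX x; apply/eqP; rewrite eq_le measure_ge0 andbT leNgt; apply/negP => x0.
have fin B : measurable B -> distribution P X B \is a fin_num.
  by move=> mB; exact: fin_num_measure.
have le_cdf y : y < x -> (cdf X y + distribution P X [set x] <= cdf X x)%E.
  move=> yx; rewrite -[leLHS]measureU//.
  - rewrite le_measure ?inE//; first exact: measurableU.
    move=> z [zy|zx]; rewrite /= in_itv/=; last by rewrite zx.
    by move: zy; rewrite /= in_itv/= => /le_trans; apply; exact: ltW.
  - apply/seteqP; split => // z [zy zx]; move: zy.
    by rewrite zx /= in_itv/= leNgt yx.
have lt_x : (cdf X x - distribution P X [set x] < cdf X x)%E.
  by rewrite lteBlDr ?fin// lteDl ?fin.
have /near_gt_cvge/(_ lt_x) : cdf X y @[y --> x^'-] --> cdf X x.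
  exact/cvg_at_left_filter/cX.
move=> /(filterI (nbhs_left_lt x))/filter_ex[y [yx]].
by rewrite lteBlDr ?fin// ltNge le_cdf.
Qed.

(** * Both limits, taken with all noises on the unit interval *)

Theorem proposition3p3 (R : realType) (d : measure_display)
    (T : measurableType d) (P : probability T R)
    (p : nat) (X : {RV P >-> p.-tuple R}) (f : {mfun p.-tuple R >-> R})
    (fX : {RV P >-> R}) (fXE : forall w, fX w = f (X w))
    (eps_ : nat -> {RV P >-> R}) (eps : {RV P >-> R})
    (Y_ : nat -> {RV P >-> R}) (Y : {RV P >-> R})
    (Y_E : forall n w, Y_ n w = f (X w) + eps_ n w)
    (YE : forall w, Y w = f (X w) + eps w)
    (fX_cont : continuous (cdf fX))
    (fX_eps_ : forall n, independent_RVs P fX (eps_ n))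
    (fX_eps : independent_RVs P fX eps)
    (eps_cvg : cvg_in_distribution eps_ eps) :
  [/\ forall n, exists nu, is_markov_product (Y_ n) fX nu,
      exists nu, is_markov_product Y fX nu,
      forall (nu_ : nat -> probability (R * R)%type R)
          (nu : probability (R * R)%type R),
        (forall n, is_markov_product (Y_ n) fX (nu_ n)) ->
        is_markov_product Y fX nu ->
        weakly_cvg_R2 nu_ nu &
      (forall n, independent_RVs P X (eps_ n)) -> independent_RVs P X eps ->
        xi (Y_ n) X @[n --> \oo] --> xi Y X].
Proof.
pose idR : {mfun R >-> R} := mfun_of (@measurable_id _ R setT).
have Y_E' n w : Y_ n w = idR (fX w) + eps_ n w by rewrite Y_E fXE.
have YE' w : Y w = idR (fX w) + eps w by rewrite YE fXE.
pose L : probability (measurableTypeR R) R := uniform_prob (@ltr01 R).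
pose q_ n : {mfun measurableTypeR R >-> R} := quantile (eps_ n).
pose q : {mfun measurableTypeR R >-> R} := quantile eps.
have q_E n A : measurable A -> L (q_ n @^-1` A) = P (eps_ n @^-1` A).
  exact: distribution_quantile.
have qE A : measurable A -> L (q @^-1` A) = P (eps @^-1` A).
  exact: distribution_quantile.
have q_q : {ae L, forall u, q_ n u @[n --> \oo] --> q u} by exact: ae_cvg_quantile.
pose rho : probability R R := distribution P fX.
have rho0 := cdf_continuous_atomless fX_cont.
split.
(* For existence the noise represents itself: [L] is [P] and [q] is [eps_ n]. *)
- by move=> n; exact: (markov_product_exists (L := P) (Y_E' n) (fX_eps_ n)).
- exact: (markov_product_exists (L := P) YE' fX_eps).
- move=> nu_ nu nu_Y nuY g cg bg.
  have mg := continuous_measurable_fun2 cg.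
  have mV (h : {mfun measurableTypeR R >-> R}) := measurable_noisy_pair idR h.
  (* Uniqueness replaces the given Markov products by laws of [noisy_pair] on one fixed space. *)
  have nuE := markov_productE YE' fX_eps qE nuY.
  have nu_E n := markov_productE (Y_E' n) (fX_eps_ n) (q_E n) (nu_Y n).
  rewrite (integral_preimage (mV q) (fun A mA => esym (nuE A mA)) mg bg).
  rewrite (_ : (fun n => _) = fun n =>
    (\int[rho \x (L \x L)]_z (g (noisy_pair idR (q_ n) z))%:E)%E); last first.
    apply/funext => n.
    exact: (integral_preimage (mV (q_ n)) (fun A mA => esym (nu_E n A mA)) mg bg).
  have [M gM] : exists M : R, forall y, `|g y| <= M.
    by case: bg => M [_ gM]; exists (M + 1) => y; apply: gM; rewrite ?ltrDl.
  apply: (@bounded_convergence _ _ _ (rho \x (L \x L))%E _ _ M) => //.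
  + by move=> n; exact: measurableT_comp mg (mV (q_ n)).
  + exact: measurableT_comp mg (mV q).
  + have q1 := ae_snd rho (ae_fst L q_q); have q2 := ae_snd rho (ae_snd L q_q).
    apply: filterS2 q1 q2 => z z1 z2.
    have c1 : idR z.1 + q_ n z.2.1 @[n --> \oo] --> idR z.1 + q z.2.1.
      by apply: cvgD => //; exact: cvg_cst.
    have c2 : idR z.1 + q_ n z.2.2 @[n --> \oo] --> idR z.1 + q z.2.2.
      by apply: cvgD => //; exact: cvg_cst.
    exact: (cvg_comp _ _ (cvg_pair c1 c2) (cg (noisy_pair idR q z))).
(* Independence of [f(X)] and [eps] alone would not give the formula for [xi]: were [eps] a
   coordinate of [X], [Y] would be a function of [X] and [xi Y X] would be 1. *)
- move=> X_eps_ X_eps.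
  rewrite (xi_noise fXE YE X_eps fX_eps qE).
  under eq_fun do rewrite (xi_noise fXE (Y_E _) (X_eps_ _) (fX_eps_ _) (q_E _)).
  apply: cvgM; first exact: cvg_integral_tail_variance.
  apply: cvgV; last exact: cvg_integral_tail_variance.
  have tailE y := tail_YE fXE YE fX_eps qE y.
  have law := law_noise fXE YE fX_eps qE.
  have mz : measurable_fun setT (fun z : R * measurableTypeR R => z.1 + q z.2).
    by apply: measurable_funD => //; exact: measurableT_comp.
  (* What remains is that the limiting denominator is nonzero. The tail of [Y] is a first tail
     moment over the atomless [rho], hence continuous. *)
  have tail_cont : continuous (tail (distribution P Y)).
    rewrite (_ : tail _ = tail_moment rho (distribution L q) 1).
      exact: tail_moment_continuous.
    by apply/funext => y; exact: tailE.
  have := tail_variance_gt0 tail_cont.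
  under eq_Rintegral do rewrite tailE -/(tail_variance _ _ 1 _).
  rewrite /Rintegral (integral_preimage mz law).
  + by move=> /gt_eqF ->.
  + exact: measurable_tail_variance.
  + exists 1; split=> [|K K1 z _]; first exact: num_real.
    exact: le_trans (norm_tail_variance _ _ _ _) (ltW K1).
Qed.
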